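(* For every constant $\varepsilon>0$ and every $n$-qubit pure state $|\psi\rangle\in\mathcal{H}_2^{\otimes n}$, there exists a quantum state tree representing $|\psi\rangle$ of size $O\left(\mathrm{TS}(|\psi\rangle)^{1+\varepsilon}\right)$ and depth $O\left(\log \mathrm{TS}(|\psi\rangle)\right)$, as well as a manifestly orthogonal quantum state tree representing $|\psi\rangle$ of size $O\left(\mathrm{MOTS}(|\psi\rangle)^{1+\varepsilon}\right)$ and depth $O\left(\log \mathrm{MOTS}(|\psi\rangle)\right)$. Here the implied constants depend only on $\varepsilon$.
   Context: $\mathcal{H}_2=\mathbb{C}^2$ with basis $|0\rangle,|1\rangle$; $\mathcal{H}_2^{\otimes n}$ has the fixed orthonormal basis $\{|x\rangle : x\in\{0,1\}^n\}$. A quantum state tree over $\mathcal{H}_2^{\otimes n}$ is a rooted tree in which each leaf is labeled with $\alpha|0\rangle+\beta|1\rangle$ for some $\alpha,\beta\in\mathbb{C}$, each non-leaf vertex (gate, of arbitrary fan-in) is labeled with $+$ or $\otimes$, and each vertex $v$ is labeled with a set $S(v)\subseteq\{1,\dots,n\}$ (of qubits) such that: (i) $|S(v)|=1$ if $v$ is a leaf; (ii) $S(v)=\{1,\dots,n\}$ if $v$ is the root; (iii) if $v$ is a $+$ gate and $w$ is a child of $v$ then $S(w)=S(v)$; (iv) if $v$ is a $\otimes$ gate with children $w_1,\dots,w_k$ then $S(w_1),\dots,S(w_k)$ form a partition of $S(v)$. The outgoing edges of each $+$ gate are labeled with complex numbers. The subtree at $v$ represents a state of the qubits in $S(v)$ in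 the obvious way (a $+$ gate gives the linear combination of its children with the edge labels as coefficients; a $\otimes$ gate gives the tensor product), and this state is required to be normalized for every $v$. The size of a tree is its number of leaves. A tree is manifestly orthogonal if for every $+$ gate and any two of its children, representing $|\psi_1\rangle,|\psi_2\rangle$, for every basis state $|x\rangle$ either $\langle\psi_1|x\rangle=0$ or $\langle\psi_2|x\rangle=0$. $\mathrm{TS}(|\psi\rangle)$ (resp. $\mathrm{MOTS}(|\psi\rangle)$) is the minimum size of a quantum state tree (resp. manifestly orthogonal quantum state tree) representing $|\psi\rangle$. *)

(* Defs.v *)
(* The complex numbers are R[i] over an arbitrary R : realType. *)
From mathcomp Require Import all_boot all_order all_algebra.
From mathcomp Require Import complex.
From mathcomp Require Import reals.

Set Implicit Arguments.
Unset Strict Implicit.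
Unset Printing Implicit Defensive.

Import Order.TTheory GRing.Theory Num.Theory.

Local Open Scope ring_scope.

(* A basis label x in {0,1}^n; false is 0 and true is 1, qubits are 0..n-1. *)
Notation bits n := {ffun 'I_n -> bool}.

(* The label set {0,1}^S of the qubits in S: a label of S is identified with its
   extension by 0 to all n qubits, so that there are 2^#|S| of them. *)
Definition basis n (S : {set 'I_n}) : {set bits n} :=
  [set x : bits n | [forall i, x i ==> (i \in S)]].

(* f x is the coefficient <x|f> of a vector f of the qubits in S; only the
   values at x \in basis S matter. *)
Definition normalized (R : realType) n (S : {set 'I_n}) (f : bits n -> R[i]) :
    bool :=
  \sum_(x in basis S) `|f x| ^+ 2 == 1.

Definition pure_state (R : realType) n (psi : bits n -> R[i]) : bool :=
  normalized [set: 'I_n] psi.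

(* Leaf j a b is a leaf on the qubit j labelled a|0> + b|1>.  Each gate carries
   its set of qubits, and each child of a + gate comes with its edge label. *)
Inductive qtree (R : realType) (n : nat) : Type :=
| Leaf of 'I_n & R[i] & R[i]
| Plus of {set 'I_n} & seq (R[i] * qtree R n)
| Tens of {set 'I_n} & seq (qtree R n).

Section QuantumStateTree.
Variables (R : realType) (n : nat).
Implicit Types (t v w : qtree R n) (x : bits n) (psi : bits n -> R[i]).

Definition qubits v : {set 'I_n} :=
  match v with
  | Leaf j _ _ => [set j]
  | Plus Q _ => Q
  | Tens Q _ => Q
  end.

(* Coefficient of the state represented by v on (the restriction to qubits v
   of) x; in a quantum state tree it depends only on the bits of x in qubits v. *)
Fixpoint amp v x : R[i] :=
  match v with
  | Leaf j a b => if x j then b else a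
  | Plus _ ws => \sum_(c <- [seq e.1 * amp e.2 x | e <- ws]) c
  | Tens _ ws => \prod_(c <- [seq amp w x | w <- ws]) c
  end.

(* The vertices of t, each given as the subtree rooted there. *)
Fixpoint vertices t : seq (qtree R n) :=
  t :: match t with
       | Leaf _ _ _ => [::]
       | Plus _ ws => flatten [seq vertices e.2 | e <- ws]
       | Tens _ ws => flatten [seq vertices w | w <- ws]
       end.

Fixpoint tree_size t : nat :=
  match t with
  | Leaf _ _ _ => 1
  | Plus _ ws => sumn [seq tree_size e.2 | e <- ws]
  | Tens _ ws => sumn [seq tree_size w | w <- ws]
  end.

(* Number of edges on a longest path from the root to a leaf. *)
Fixpoint tree_depth t : nat :=
  match t with
  | Leaf _ _ _ => 0
  | Plus _ ws => (foldr maxn 0 [seq tree_depth e.2 | e <- ws]).+1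
  | Tens _ ws => (foldr maxn 0 [seq tree_depth w | w <- ws]).+1
  end.

(* Gates are non-leaf vertices, hence have at least one child.  The blocks of a
   partition are nonempty; uniq is needed because [set:: _] forgets repetitions. *)
Definition gate_ok v : bool :=
  match v with
  | Leaf _ _ _ => true
  | Plus Q ws => (0 < size ws)%N && all (fun e => qubits e.2 == Q) ws
  | Tens Q ws =>
      let Qs := [seq qubits w | w <- ws] in
      [&& (0 < size ws)%N, uniq Qs & partition [set:: Qs] Q]
  end.

Definition quantum_state_tree t : bool :=
  (qubits t == [set: 'I_n]) &&
  all (fun v => gate_ok v && normalized (qubits v) (amp v)) (vertices t).

(* <psi|x> is the conjugate of the coefficient of psi on x. *)
Definition disjoint_supports (Q : {set 'I_n}) v w : bool :=
  [forall x in basis Q, (amp v x == 0) || (amp w x == 0)].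

Definition manifestly_orthogonal_gate v : bool :=
  match v with
  | Plus Q ws => pairwise (disjoint_supports Q) [seq e.2 | e <- ws]
  | _ => true
  end.

Definition manifestly_orthogonal t : bool :=
  all manifestly_orthogonal_gate (vertices t).

(* Equality of vectors, not only up to a global phase. *)
Definition tree_for psi t : Prop := quantum_state_tree t /\ amp t =1 psi.

Definition mo_tree_for psi t : Prop := tree_for psi t /\ manifestly_orthogonal t.

End QuantumStateTree.

From mathcomp Require Import boolp classical_sets.

(* The least element of A; the default value 0 for empty A is never met by TS and
   MOTS of an n-qubit state with 0 < n (lemmas TSP and MOTSP). *)
Definition least (A : set nat) : nat :=
  xget 0%N [set s | A s /\ forall s', A s' -> (s <= s')%N].

Definition TS (R : realType) n (psi : bits n -> R[i]) : nat :=
  least [set s | exists2 t, tree_for psi t & tree_size t = s].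

Definition MOTS (R : realType) n (psi : bits n -> R[i]) : nat :=
  least [set s | exists2 t, mo_tree_for psi t & tree_size t = s].

Lemma leastP (A : set nat) (s0 : nat) :
  A s0 -> A (least A) /\ forall s, A s -> (least A <= s)%N.
Proof.
move=> As0; have exA : exists s, `[< A s >] by exists s0; exact/asboolP.
case: (ex_minnP exA) => m /asboolP Am minm.
rewrite /least; case: xgetP => [s -> //|/(_ m)]; case; split=> // s' As'.
by apply: minm; exact/asboolP.
Qed.

Section Existence.
Variables (R : realType) (n : nat).

Definition basis_tree (x : bits n) : qtree R n :=
  Tens [set: 'I_n] [seq Leaf j (~~ x j)%:R (x j)%:R | j <- enum 'I_n].

Definition sum_tree (psi : bits n -> R[i]) : qtree R n :=
  Plus [set: 'I_n] [seq (psi x, basis_tree x) | x : bits n].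

Lemma amp_basis_tree x y : amp (basis_tree x) y = (x == y)%:R.
Proof.
rewrite /= -map_comp big_map big_enum /=.
case: eqP => [->|/eqP neq].
  by apply: big1 => j _; case: (y j).
have [j xyj] : exists j, x j != y j.
  by apply/existsP; apply: contraNT neq; rewrite negb_exists => /forallP xy;
     apply/eqP/ffunP => j; apply/eqP; move: (xy j); rewrite negbK.
by rewrite (bigD1 j) //= ; move: xyj; case: (x j) (y j) => -[] //=; rewrite mul0r.
Qed.

Lemma amp_sum_tree psi : amp (sum_tree psi) =1 psi.
Proof.
move=> y; rewrite [LHS]/= -map_comp big_map big_enum (bigD1 y) //=.
rewrite -[X in _ * X + _]/(amp (basis_tree y) y) amp_basis_tree eqxx mulr1.
rewrite big1 ?addr0 // => x xy.
by rewrite -[X in _ * X]/(amp (basis_tree x) y) amp_basis_tree (negPf xy) mulr0.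
Qed.

Lemma basisT : basis [set: 'I_n] = [set: bits n].
Proof. by apply/setP => x; rewrite !inE; apply/forallP => i; rewrite inE implybT. Qed.

Lemma normalized_leaf (j : 'I_n) (b : bool) :
  normalized [set j] (amp (Leaf j (~~ b)%:R b%:R : qtree R n)).
Proof.
pose z : bits n := [ffun i => (i == j) && b].
have zj : z j = b by rewrite ffunE eqxx.
rewrite /normalized (bigD1 z) /=; last first.
  by rewrite inE; apply/forallP => i; rewrite ffunE inE; case: (i == j); rewrite ?implybT.
rewrite zj; have -> : (if b then b%:R else (~~ b)%:R) = 1 :> R[i] by case: (b).
rewrite normr1 expr1n big1 ?addr0 // => y /andP[]; rewrite inE => /forallP yj neq.
have yjb : y j != b.
  apply: contra neq => /eqP yj'; apply/eqP/ffunP => i; rewrite ffunE.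
  have [->|ij] := eqVneq i j; first by rewrite yj'.
  by move: (yj i); rewrite inE (negPf ij) implybF => /negPf.
by move: yjb; case: (y j) (b) => -[] //=; rewrite normr0 expr0n.
Qed.

Lemma sum_tree_ok psi : (0 < n)%N -> pure_state psi -> mo_tree_for psi (sum_tree psi).
Proof.
move=> n0 psi1; have n0E : (0 < size (enum 'I_n))%N by rewrite size_enum_ord.
have okb x : all (fun v => gate_ok v && normalized (qubits v) (amp v))
    (vertices (basis_tree x)) && all (@manifestly_orthogonal_gate R n) (vertices (basis_tree x)).
  rewrite [vertices _]/=; set vs := flatten _.
  have -> : vs = [seq Leaf j (~~ x j)%:R (x j)%:R | j <- enum 'I_n].
    by rewrite /vs -map_comp; elim: (enum _) => //= j s ->.
  rewrite /= !all_map; apply/andP; split; last by apply/allP.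
  apply/andP; split; last by apply/allP => j _; exact: normalized_leaf.
  apply/andP; split.
    apply/and3P; split; first by rewrite size_map.
      by rewrite -map_comp map_inj_uniq ?enum_uniq // => i j; exact: set1_inj.
    apply/and3P; split.
    - apply/eqP/setP => i; rewrite inE; apply/bigcupP; exists [set i]; last by rewrite set11.
      by rewrite inE -map_comp; apply/mapP; exists i; rewrite ?mem_enum.
    - apply/finset.trivIsetP => A B; rewrite !inE -map_comp => /mapP[i _ ->] /mapP[k _ ->] ik.
      by rewrite disjoints1 inE; apply: contra ik => /= /eqP ->.
    - by rewrite inE -map_comp; apply/mapP => -[i _ /setP/(_ i)]; rewrite !inE eqxx.
  rewrite -[X in normalized _ X]/(amp (basis_tree x)) /normalized basisT.
  rewrite (bigD1 x) ?inE // amp_basis_tree eqxx normr1 expr1n big1; first by rewrite /= addr0.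
  by move=> y /andP[_ yx]; rewrite amp_basis_tree eq_sym (negPf yx) normr0 expr0n.
have flat (a : pred (qtree R n)) : (forall x, all a (vertices (basis_tree x))) ->
    all a (flatten [seq vertices e.2 | e <- [seq (psi x, basis_tree x) | x : bits n]]).
  move=> h; rewrite -map_comp; elim: (enum _) => // x s IH.
  by rewrite -[is_true _]/(is_true (all a (vertices (basis_tree x) ++ _))) all_cat h.
split; first (split; last exact: amp_sum_tree).
  apply/andP; split; first exact: eqxx.
  apply/andP; split; last by apply: flat => x; case/andP: (okb x).
  apply/andP; split; last first.
    apply/eqP; rewrite -(eqP psi1); apply: eq_bigr => y _; congr (`|_| ^+ 2).
    exact: amp_sum_tree.
  apply/andP; split; first by rewrite size_map -cardE; apply/card_gt0P; exists [ffun=> false].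
  by rewrite all_map; apply/allP => x _; rewrite /= eqxx.
apply/andP; split; last by apply: flat => x; case/andP: (okb x).
rewrite /= -map_comp pairwise_map; apply: (@sub_in_pairwise _ predT (fun x y => x != y)).
- move=> x y _ _ /= xy; apply/forallP => z; apply/implyP => _.
  rewrite -!/(amp (basis_tree _) z) !amp_basis_tree !pnatr_eq0 !eqb0 -negb_and.
  by apply: contra xy => /andP[/eqP-> /eqP->].
- by rewrite all_predT.
- by rewrite -uniq_pairwise enum_uniq.
Qed.

End Existence.

Lemma TSP (R : realType) n (psi : bits n -> R[i]) :
  (0 < n)%N -> pure_state psi ->
  (exists2 t, tree_for psi t & tree_size t = TS psi) /\
  forall t, tree_for psi t -> (TS psi <= tree_size t)%N.
Proof.
move=> n0 psi1; have [ok _] := sum_tree_ok n0 psi1.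
have [att low] : [set s | exists2 t, tree_for psi t & tree_size t = s]%classic (TS psi)
    /\ _ := leastP (ex_intro2 _ _ _ ok erefl).
by split=> // t tpsi; apply: low; exists t.
Qed.

Lemma MOTSP (R : realType) n (psi : bits n -> R[i]) :
  (0 < n)%N -> pure_state psi ->
  (exists2 t, mo_tree_for psi t & tree_size t = MOTS psi) /\
  forall t, mo_tree_for psi t -> (MOTS psi <= tree_size t)%N.
Proof.
move=> n0 psi1; have ok := sum_tree_ok n0 psi1.
have [att low] : [set s | exists2 t, mo_tree_for psi t & tree_size t = s]%classic (MOTS psi)
    /\ _ := leastP (ex_intro2 _ _ _ ok erefl).
by split=> // t tpsi; apply: low; exists t.
Qed.

(* Main.v *)
(* Restructuring in the style of Bshouty, Cleve and Eberly.  Let m = K^i.  A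
   formula with s <= K m leaves is cut along a heaviest path into pieces of at
   most m leaves.  A piece with a hole v computes G + H v, because every
   formula is multilinear, and manifest orthogonality is preserved: the supports
   of G and H v partition the support of the piece.  Each leaf is used at most
   twice (in G and in H), and the depth grows by 3 (K - 1).  Hence K^i leaves
   can be brought to depth O(K i) at the cost of a factor 2^i in size, and with
   2 <= K^eps this factor is at most 2 s^eps.  Normalization of the states is
   ignored during the restructuring and restored at the end, after removing the
   vertices that represent zero. *)
Require Import Defs.
From mathcomp Require Import boolp classical_sets reals exp.
(* After classical_sets, so that set0, setT, ... are those of finset. *)
From mathcomp Require Import all_boot all_order all_algebra.
From mathcomp Require Import complex.
From mathcomp Require Import zify lra.

Set Implicit Arguments.
Unset Strict Implicit.
Unset Printing Implicit Defensive.

Import Order.TTheory GRing.Theory Num.Theory.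

Local Open Scope ring_scope.

(** * Depth reduction for unnormalized binary formulas *)

Section Formulas.
Variables (R : realType) (n : nat) (mo : bool).
Local Notation C := R[i].
Implicit Types (Q : {set 'I_n}) (x y z : bits n) (f g : bits n -> C) (s d c m k : nat).

(* Binary formulas, not normalized: formula Q f s d says that the vector f of
   the qubits in Q has a formula with s qubit leaves and depth d, which is
   manifestly orthogonal when mo is set.  The zero vector and the scalars (the
   vectors of no qubits) are leaves of size 0. *)
Inductive formula : {set 'I_n} -> (bits n -> C) -> nat -> nat -> Prop :=
| Fzero Q : formula Q (fun=> 0) 0 0
| Fconst (a : C) : formula set0 (fun=> a) 0 0
| Fleaf j (a b : C) : formula [set j] (fun x => if x j then b else a) 1 0
| Fadd Q f g s1 s2 d1 d2 :
    formula Q f s1 d1 -> formula Q g s2 d2 ->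
    (mo -> forall x, f x = 0 \/ g x = 0) ->
    formula Q (fun x => f x + g x) (s1 + s2) (maxn d1 d2).+1
| Fmul Q1 Q2 f g s1 s2 d1 d2 :
    formula Q1 f s1 d1 -> formula Q2 g s2 d2 -> [disjoint Q1 & Q2] ->
    formula (Q1 :|: Q2) (fun x => f x * g x) (s1 + s2) (maxn d1 d2).+1.

Definition local_on Q f := forall x y, {in Q, x =1 y} -> f x = f y.

Lemma formula_local Q f s d : formula Q f s d -> local_on Q f.
Proof.
elim=> {Q f s d}[Q|a|j a b|Q f g s1 s2 d1 d2 _ IHf _ IHg _|
  Q1 Q2 f g s1 s2 d1 d2 _ IHf _ IHg _] x y xy //.
- by rewrite xy ?set11.
- by rewrite (IHf x y) // (IHg x y).
- by rewrite (IHf x y) ?(IHg x y) // => i iQ; apply: xy; rewrite inE iQ ?orbT.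
Qed.

(** Among the base cases only [Fzero] can have fewer leaves than qubits, and a zero vector drops out
    of a sum and annihilates a product. *)
Lemma formula_card Q f s d :
  formula Q f s d -> (forall x, f x = 0) \/ (#|Q| <= s)%N.
Proof.
elim=> {Q f s d}[Q|a|j a b|Q f g s1 s2 d1 d2 _ [f0|Qs] _ [g0|Qs'] _|
  Q1 Q2 f g s1 s2 d1 d2 _ [f0|Qs] _ [g0|Qs'] _].
- by left.
- by right; rewrite cards0.
- by right; rewrite cards1.
- by left=> x; rewrite f0 g0 addr0.
- by right; lia.
- by right; lia.
- by right; lia.
- by left=> x; rewrite f0 mul0r.
- by left=> x; rewrite f0 mul0r.
- by left=> x; rewrite g0 mulr0.
- by right; rewrite (leq_trans (leq_card_setU Q1 Q2)) ?leq_add.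
Qed.

(** Base of the recursion. By [formula_card] at most one qubit is left unless f is zero; locality
    then makes f zero, a scalar or a one-qubit vector, however deep its formula was. *)
Lemma formula_size_le1 Q f s d :
  formula Q f s d -> (s <= 1)%N -> exists2 s', (s' <= s)%N & formula Q f s' 0.
Proof.
move=> Ff s1; case: (formula_card Ff) => [f0|Qs].
  by exists 0%N => //; have -> : f = fun=> 0 by [apply: funext]; exact: Fzero.
have fQ := formula_local Ff.
case: (posnP #|Q|) => [/eqP|Q0].
  rewrite cards_eq0 => /eqP Q0; exists 0%N => //; rewrite Q0 in fQ *.
  suff -> : f = fun=> f [ffun=> false] by exact: Fconst.
  by apply: funext => x; apply: fQ => i; rewrite inE.
have /eqP/cards1P[j Qj] : #|Q| = 1%N by lia.
exists 1%N; first by lia.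
rewrite Qj in fQ *.
suff -> : f = fun x => if x j then f [ffun=> true] else f [ffun=> false].
  exact: Fleaf.
by apply: funext => x; case: ifP => xj; apply: fQ => i; rewrite inE => /eqP->;
  rewrite ffunE.
Qed.

(** The scalar is a factor on no qubits: it costs depth but no leaf. *)
Lemma formulaZ Q f s d (a : C) :
  formula Q f s d -> exists d', formula Q (fun x => a * f x) s d'.
Proof.
move=> Ff; exists (maxn 0 d).+1.
rewrite -[Q]set0U -[s]add0n; apply: Fmul (Fconst a) Ff _.
by rewrite -setI_eq0 set0I.
Qed.

(* f = G + H v: cut f at a vertex v.  G is f with v replaced by 0 and H is the
   product of the siblings of the (x) gates above v, so both are bounded by the
   number c' of leaves outside v.  Descending to the larger child as long as at
   most m leaves stay outside, with c leaves already outside f, one stops at a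
   leaf or at a gate both of whose children leave more than m leaves outside;
   the latter can be rebuilt from any formulas for its children. *)
Definition splits Q f s c m := exists G H v Q1 Q2 sG sH c' dG dH,
  [/\ f = (fun x => G x + H x * v x),
      (mo -> forall x, G x = 0 \/ H x * v x = 0),
      Q = Q1 :|: Q2 /\ [disjoint Q1 & Q2],
      formula Q G sG dG /\ formula Q1 H sH dH
    & [/\ (sG <= c')%N, (sH <= c')%N, (c + c' <= m)%N
    & (exists2 sv, formula Q2 v sv 0 & (c' + sv = s)%N) \/
      exists Qa Qb va vb sa sb da db,
        [/\ formula Qa va sa da, formula Qb vb sb db, (c' + sa + sb = s)%N,
            (m < c + c' + sa)%N /\ (m < c + c' + sb)%N
          & forall sa' sb' da' db',
              formula Qa va sa' da' -> formula Qb vb sb' db' ->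
              formula Q2 v (sa' + sb') (maxn da' db').+1]]].

Lemma splits_nil Q f s c m : (c <= m)%N ->
  (formula Q f s 0 \/
   exists Qa Qb va vb sa sb da db,
     [/\ formula Qa va sa da, formula Qb vb sb db, (sa + sb = s)%N,
         (m < c + sa)%N /\ (m < c + sb)%N
       & forall sa' sb' da' db',
           formula Qa va sa' da' -> formula Qb vb sb' db' ->
           formula Q f (sa' + sb') (maxn da' db').+1]) ->
  splits Q f s c m.
Proof.
move=> cm fE.
exists (fun=> 0), (fun=> 1), f, set0, Q, 0%N, 0%N, 0%N, 0%N, 0%N; split.
- by apply: funext => x; rewrite add0r mul1r.
- by left.
- by rewrite set0U -setI_eq0 set0I.
- by split; [exact: Fzero | exact: Fconst].
rewrite addn0; split=> //; case: fE => [Ff|fE]; [by left; exists s | by right].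
Qed.

(** Descent through a + gate: the sibling g joins G, and its [s2] leaves now count as outside. As G
    and H v have disjoint supports, both lie in the support of f, hence off that of g. *)
Lemma splits_add Q f g s1 s2 d2 c m :
  splits Q f s1 (c + s2) m -> formula Q g s2 d2 ->
  (mo -> forall x, f x = 0 \/ g x = 0) ->
  splits Q (fun x => f x + g x) (s1 + s2) c m.
Proof.
move=> [G [H [v [Q1 [Q2 [sG [sH [c' [dG [dH]]]]]]]]]].
move=> [-> GHv QE [FG FH] [sGc sHc cm alt]] Fg fg.
have Gg : mo -> forall x, G x = 0 \/ g x = 0.
  move=> mo1 x; case: (GHv mo1 x) => [->|Hv]; first by left.
  by case: (fg mo1 x); rewrite ?Hv ?addr0; [left | right].
exists (fun x => G x + g x), H, v, Q1, Q2, (sG + s2)%N, sH, (c' + s2)%N.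
exists (maxn dG d2).+1, dH; split=> //.
- by apply: funext => x; rewrite addrAC.
- move=> mo1 x; case: (GHv mo1 x) => [G0|->]; last by right.
  by case: (fg mo1 x) => [|->]; rewrite G0 ?add0r ?addr0; [right | left].
- by split=> //; exact: Fadd.
split; [lia..|case: alt => [[sv Fv sE]|]].
  by left; exists sv => //; lia.
move=> [Qa [Qb [va [vb [sa [sb [da [db [Fa Fb sE [ma mb] op]]]]]]]]]; right.
by exists Qa, Qb, va, vb, sa, sb, da, db; split=> //; lia.
Qed.

(** Descent through a product: g distributes over G + H v and is copied into both G and H, the only
    place where leaves are duplicated. *)
Lemma splits_mul Q Q' f g s1 s2 d2 c m :
  splits Q f s1 (c + s2) m -> formula Q' g s2 d2 -> [disjoint Q & Q'] ->
  splits (Q :|: Q') (fun x => f x * g x) (s1 + s2) c m.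
Proof.
move=> [G [H [v [Q1 [Q2 [sG [sH [c' [dG [dH]]]]]]]]]].
move=> [-> GHv [QE Q12] [FG FH] [sGc sHc cm alt]] Fg QQ'.
have [Q1Q' Q2Q'] : [disjoint Q1 & Q'] /\ [disjoint Q2 & Q'].
  by move: QQ'; rewrite QE -!setI_eq0 setIUl setU_eq0 => /andP.
exists (fun x => G x * g x), (fun x => H x * g x), v, (Q1 :|: Q'), Q2.
exists (sG + s2)%N, (sH + s2)%N, (c' + s2)%N, (maxn dG d2).+1, (maxn dH d2).+1.
split.
- by apply: funext => x; rewrite mulrDl mulrAC.
- move=> mo1 x; rewrite mulrAC.
  by case: (GHv mo1 x) => ->; [left | right]; rewrite mul0r.
- split; first by rewrite QE setUAC.
  by rewrite -setI_eq0 setIUl setU_eq0 !setI_eq0 Q12 disjoint_sym.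
- by split; exact: Fmul.
split; [lia..|case: alt => [[sv Fv sE]|]].
  by left; exists sv => //; lia.
move=> [Qa [Qb [va [vb [sa [sb [da [db [Fa Fb sE [ma mb] op]]]]]]]]]; right.
by exists Qa, Qb, va, vb, sa, sb, da, db; split=> //; lia.
Qed.

Lemma formula_splits Q f s d c m :
  formula Q f s d -> (c <= m)%N -> splits Q f s c m.
Proof.
move=> Ff; elim: Ff c => {Q f s d}[Q|a|j a b|Q f g s1 s2 d1 d2 Ff IHf Fg IHg fg|
  Q1 Q2 f g s1 s2 d1 d2 Ff IHf Fg IHg Q12] c cm.
- by apply: splits_nil => //; left; exact: Fzero.
- by apply: splits_nil => //; left; exact: Fconst.
- by apply: splits_nil => //; left; exact: Fleaf.
(* Either child will do as long as its sibling fits in the budget m; when neither sibling fits, the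
   descent stops here. *)
- have [cs2|cs2] := leqP (c + s2) m; first by apply: splits_add (IHf _ cs2) Fg fg.
  have [cs1|cs1] := leqP (c + s1) m.
    rewrite addnC (_ : (fun x => _) = fun x => g x + f x); last first.
      by apply: funext => x; rewrite addrC.
    by apply: splits_add (IHg _ cs1) Ff _ => mo1 x; case: (fg mo1 x); [right|left].
  apply: splits_nil => //; right; exists Q, Q, f, g, s1, s2, d1, d2.
  by split=> // *; exact: Fadd.
- have [cs2|cs2] := leqP (c + s2) m; first by apply: splits_mul (IHf _ cs2) Fg Q12.
  have [cs1|cs1] := leqP (c + s1) m.
    rewrite addnC setUC (_ : (fun x => _) = fun x => g x * f x); last first.
      by apply: funext => x; rewrite mulrC.
    by apply: splits_mul (IHg _ cs1) Ff _; rewrite disjoint_sym.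
  apply: splits_nil => //; right; exists Q1, Q2, f, g, s1, s2, d1, d2.
  by split=> // *; exact: Fmul.
Qed.

Definition balanced Q f s d :=
  exists s' d', [/\ (s' <= s)%N, (d' <= d)%N & formula Q f s' d'].

(* Replacing f by G + H v, where G and H have size at most m and the children of
   v are treated recursively, uses two parts (G and H) of at most c' leaves in
   place of c' leaves: the ratio size/s doubles only once, although there may be
   j levels of recursion. *)
Lemma balanced_step m (A D : nat) : (0 < A)%N ->
  (forall Q f s d, formula Q f s d -> (s <= m)%N -> balanced Q f (A * s) D) ->
  forall j Q f s d, formula Q f s d -> (s <= m + j * m)%N ->
    balanced Q f (2 * A * s) (D + 3 * j).
Proof.
move=> A0 bal; elim=> [|j IHj] Q f s d Ff sm.
  case: (bal _ _ _ _ Ff) => [|s' [d' [s'A d'D F']]]; first by lia.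
  by exists s', d'; split=> //; lia.
have [] := formula_splits Ff (leq0n m).
move=> G [H [v [Q1 [Q2 [sG [sH [c' [dG [dH]]]]]]]]].
move=> [-> GHv [-> Q12] [FG FH] [sGc sHc cm alt]].
have [|sG' [dG' [sGA dGD FG']]] := bal _ _ _ _ FG; first by lia.
have [|sH' [dH' [sHA dHD FH']]] := bal _ _ _ _ FH; first by lia.
have sGc' : (sG' <= A * c')%N by apply: leq_trans sGA _; rewrite leq_mul2l sGc orbT.
have sHc' : (sH' <= A * c')%N by apply: leq_trans sHA _; rewrite leq_mul2l sHc orbT.
have [sv [dv [svs dvD Fv]]] :
    exists sv dv, [/\ (sG' + (sH' + sv) <= 2 * A * s)%N, (dv <= (D + 3 * j).+1)%N
                    & formula Q2 v sv dv].
  case: alt => [[sv Fv sE]|]; first by exists sv, 0%N; split=> //; nia.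
  move=> [Qa [Qb [va [vb [sa [sb [da [db [Fa Fb sE [ma mb] op]]]]]]]]].
  (* More than m leaves lie outside each child, so it has fewer than s - m <= m + j m of them. *)
  have [|sa' [da' [saA daD Fa']]] := IHj _ _ _ _ Fa; first by lia.
  have [|sb' [db' [sbA dbD Fb']]] := IHj _ _ _ _ Fb; first by lia.
  exists (sa' + sb')%N, (maxn da' db').+1; split; [by nia|by lia|exact: op Fa' Fb'].
(* The sum, the product and the gate of v make up the three levels added per round. *)
exists (sG' + (sH' + sv))%N, (maxn dG' (maxn dH' dv).+1).+1; split=> //; first by lia.
by apply: Fadd FG' (Fmul FH' Fv Q12) _.
Qed.

(** With m = K^i and K = k + 1, K^(i+1) = m + k m, so each further power of K takes one
    [balanced_step] with j = k. *)
Lemma formula_balanced k i Q f s d :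
  formula Q f s d -> (s <= k.+1 ^ i)%N -> balanced Q f (2 ^ i * s) (3 * k * i).
Proof.
elim: i Q f s d => [|i IHi] Q f s d Ff sk.
  by have [s' s's F'] := formula_size_le1 Ff sk; exists s', 0%N; rewrite mul1n.
rewrite expnS mulnS addnC; apply: (balanced_step _ IHi Ff); first by rewrite expn_gt0.
by rewrite -mulSn -expnS.
Qed.

End Formulas.

(** * From quantum state trees to formulas *)

Section Trees.
Variables (R : realType) (n : nat) (mo : bool).
Local Notation C := R[i].
Implicit Types (Q : {set 'I_n}) (x y z : bits n) (f g : bits n -> C).
Implicit Types (t v w : qtree R n).

(** Children are nested in sequences, so their induction hypotheses come as a conjunction that an
    inner induction on [ws] takes apart. *)
Fixpoint qtree_nested_ind (P : qtree R n -> Prop)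
    (Pleaf : forall j a b, P (Leaf j a b))
    (Pplus : forall Q ws, foldr and True [seq P e.2 | e <- ws] -> P (Plus Q ws))
    (Ptens : forall Q ws, foldr and True [seq P w | w <- ws] -> P (Tens Q ws))
    t : P t :=
  match t with
  | Leaf j a b => Pleaf j a b
  | Plus Q ws => Pplus Q ws
      ((fix all_ws ws : foldr and True [seq P e.2 | e <- ws] :=
        match ws with
        | [::] => I
        | e :: ws' => conj (qtree_nested_ind Pleaf Pplus Ptens e.2) (all_ws ws')
        end) ws)
  | Tens Q ws => Ptens Q ws
      ((fix all_ws ws : foldr and True [seq P w | w <- ws] :=
        match ws with
        | [::] => I
        | w :: ws' => conj (qtree_nested_ind Pleaf Pplus Ptens w) (all_ws ws')
        end) ws)
  end.

Definition restrict Q x : bits n := [ffun i => (i \in Q) && x i].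

Lemma restrict_basis Q x : restrict Q x \in basis Q.
Proof.
by rewrite inE; apply/forallP => i; rewrite ffunE; apply/implyP => /andP[].
Qed.

Lemma local_restrict Q f x : local_on Q f -> f (restrict Q x) = f x.
Proof. by apply => i iQ; rewrite ffunE iQ. Qed.

Lemma disjoint_uniq_trivIset (Qs : seq {set 'I_n}) :
  uniq Qs -> finset.trivIset [set:: Qs] ->
  pairwise (fun A B : {set 'I_n} => [disjoint A & B]) Qs.
Proof.
rewrite uniq_pairwise => Qs1 /finset.trivIsetP triv.
apply: (@sub_in_pairwise _ (mem Qs) (fun A B => A != B)) Qs1; last exact/allP.
by move=> A B AQ BQ AB; apply: triv; rewrite ?inE.
Qed.

Lemma cover_seq (Qs : seq {set 'I_n}) : finset.cover [set:: Qs] = \bigcup_(A <- Qs) A.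
Proof. by rewrite bigcup_seq; apply: eq_bigl => A; rewrite inE. Qed.

(** A gate of any fan-in becomes a chain of binary gates ending in the zero vector or the scalar 1.
    The chain may be long, but only the size matters before balancing. *)
Lemma formula_of_tree t :
  all (@gate_ok R n) (vertices t) -> (mo -> manifestly_orthogonal t) ->
  exists d, formula mo (qubits t) (amp t) (tree_size t) d.
Proof.
elim/qtree_nested_ind: t => [j a b|Q ws|Q ws] IHws.
- by exists 0%N; exact: Fleaf.
- rewrite /= => /andP[/andP[_ wsQ] ok] mows.
  have {mows} [mop mok] : (mo -> pairwise (disjoint_supports Q) [seq e.2 | e <- ws]) /\
      (mo -> all (@manifestly_orthogonal_gate R n) (flatten [seq vertices e.2 | e <- ws])).
    by split=> /mows/andP[].
  suff [d F] : exists d, formula mo Q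
      (fun x => \sum_(c <- [seq e.1 * amp e.2 x | e <- ws]) c)
      (sumn [seq tree_size e.2 | e <- ws]) d by exists d.
  elim: ws IHws wsQ ok mop mok => [|[a w] ws IH] /=.
    move=> *; exists 0%N; rewrite (_ : (fun x => _) = fun=> 0); first exact: Fzero.
    by apply: funext => x; rewrite big_nil.
  rewrite !all_cat => -[IHw IHws] /andP[/eqP wQ wsQ] /andP[okw okws] mop mok.
  have [|dw Fw] := IHw okw; first by move=> /mok /andP[].
  have {}wQ : qubits w = Q by [].
  have [||d Fws] := IH IHws wsQ okws.
  - by move=> /mop /andP[].
  - by move=> /mok /andP[].
  have [dw' Faw] := formulaZ a Fw; rewrite wQ in Faw Fw.
  exists (maxn dw' d).+1; rewrite (_ : (fun x => _) =
    fun x => a * amp w x + \sum_(c <- [seq e.1 * amp e.2 x | e <- ws]) c); last first.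
    by apply: funext => x; rewrite big_cons.
  have [lw lws] := (formula_local Fw, formula_local Fws).
  apply: Fadd Faw Fws _ => mo1 x.
  (* Supports are known to be disjoint only on labels in [basis Q]; locality extends this to all
     x. *)
  rewrite -(local_restrict x lw) -(local_restrict x lws).
  have [->|wx] := eqVneq (amp w (restrict Q x)) 0; first by left; rewrite mulr0.
  right; move: (mop mo1) => /andP[ds _].
  elim: (ws) ds => [|[b v] vs IHvs] /=; first by rewrite big_nil.
  move=> /andP[/forall_inP/(_ _ (restrict_basis Q x)) wv ds].
  by rewrite big_cons IHvs // addr0; move: wv; rewrite (negPf wx) => /eqP->; rewrite mulr0.
- rewrite /= => /andP[/and3P[_ uQ pQ] ok] mok.
  have {}mok : mo -> all (@manifestly_orthogonal_gate R n) (flatten [seq vertices w | w <- ws]).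
    by move=> /mok.
  have /and3P[/eqP <- triv _] := pQ; rewrite cover_seq.
  have {uQ triv pQ} := disjoint_uniq_trivIset uQ triv.
  elim: ws IHws ok mok => [|w ws IH] /=.
    by move=> *; exists 0%N; rewrite !big_nil; exact: Fconst.
  rewrite !all_cat => -[IHw IHws] /andP[okw okws] mok /andP[dis dws].
  have [|dw Fw] := IHw okw; first by move=> /mok /andP[].
  have [|d Fws] := IH IHws okws _ dws; first by move=> /mok /andP[].
  exists (maxn dw d).+1; rewrite big_cons (_ : (fun x => _) =
    fun x => amp w x * \prod_(c <- [seq amp w' x | w' <- ws]) c); last first.
    by apply: funext => x; rewrite big_cons.
  apply: Fmul Fw Fws _; elim: (ws) dis => [|w' ws' IHd] /=.
    by rewrite big_nil -setI_eq0 setI0.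
  move=> /andP[ww' /IHd dws']; rewrite big_cons -setI_eq0 setIUr setU_eq0.
  by rewrite !setI_eq0 ww'.
Qed.

(** * Norms, and from formulas back to normalized trees *)

Definition sqnorm Q f : C := \sum_(x in basis Q) `|f x| ^+ 2.

Lemma eq_sqnorm Q f g : f =1 g -> sqnorm Q f = sqnorm Q g.
Proof. by move=> fg; apply: eq_bigr => x _; rewrite fg. Qed.

Lemma sqnormZ Q f (a : C) : sqnorm Q (fun x => a * f x) = `|a| ^+ 2 * sqnorm Q f.
Proof. by rewrite /sqnorm big_distrr; apply: eq_bigr => x _ /=; rewrite normrM exprMn. Qed.

Lemma sqnorm_gt0 Q f x : local_on Q f -> f x != 0 -> 0 < sqnorm Q f.
Proof.
move=> fQ; rewrite -(local_restrict x fQ) => fx.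
rewrite /sqnorm (bigD1 (restrict Q x)) ?restrict_basis //=.
by rewrite ltr_wpDr ?sumr_ge0 ?exprn_gt0 ?normr_gt0 // => y _; rewrite exprn_ge0.
Qed.

(** Labels vanish outside their set, so bitwise or is a bijection from pairs of labels of Q1 and Q2
    to labels of the union. *)
Lemma sqnormM Q1 Q2 f g : [disjoint Q1 & Q2] -> local_on Q1 f -> local_on Q2 g ->
  sqnorm (Q1 :|: Q2) (fun x => f x * g x) = sqnorm Q1 f * sqnorm Q2 g.
Proof.
move=> Q12 fQ gQ; rewrite /sqnorm big_distrlr pair_big /=.
pose glue (p : bits n * bits n) : bits n := [ffun i => p.1 i || p.2 i].
rewrite (reindex_onto glue (fun x => (restrict Q1 x, restrict Q2 x))) /=; last first.
  move=> x; rewrite inE => /forallP xQ; apply/ffunP => i; rewrite !ffunE.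
  by rewrite -andb_orl -in_setU; move: (xQ i); case: (x i); rewrite ?andbF //= andbT.
have nQ i : ~~ ((i \in Q1) && (i \in Q2)).
  by apply/andP => -[/(disjointFr Q12) ->].
apply: eq_big => [[x y]|[x y]] /=.
  apply/andP/andP => [[_ /eqP[<- <-]]|[]]; first by rewrite !restrict_basis.
  rewrite !inE => /forallP xQ /forallP yQ; split.
    apply/forallP => i; rewrite ffunE inE /=; move: (xQ i) (yQ i).
    by case: (x i); case: (y i); case: (i \in Q1); case: (i \in Q2).
  apply/eqP; congr pair; apply/ffunP => i; rewrite !ffunE /=;
    move: (xQ i) (yQ i) (nQ i);
    by case: (x i); case: (y i); case: (i \in Q1); case: (i \in Q2).
move=> /andP[_ /eqP[xE yE]]; rewrite normrM exprMn -(local_restrict (glue _) fQ) xE.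
by rewrite -(local_restrict (glue _) gQ) yE.
Qed.

Lemma all_vertices_root (p : pred (qtree R n)) t : all p (vertices t) -> p t.
Proof. by case: t => [j a b|Q ws|Q ws] /= /andP[]. Qed.

Lemma normalizedE Q f : normalized Q f = (sqnorm Q f == 1).
Proof. by []. Qed.

Lemma sqnorm_rescale Q f x : local_on Q f -> f x != 0 ->
  exists2 r : C, 0 < r & sqnorm Q (fun y => r^-1 * f y) = 1.
Proof.
move=> fQ /(sqnorm_gt0 fQ) N0; exists (sqrtC (sqnorm Q f)); first by rewrite sqrtC_gt0.
by rewrite sqnormZ normfV ger0_norm ?sqrtC_ge0 ?ltW // exprVn sqrtCK mulVf ?gt_eqF.
Qed.

(* The vector is recovered only up to a positive factor, since the vertices of a
   quantum state tree are normalized. *)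
Definition realizable Q f s d := exists t (r : C),
  [/\ qubits t = Q /\ (mo -> manifestly_orthogonal t),
      all (fun v => gate_ok v && normalized (qubits v) (amp v)) (vertices t),
      0 < r /\ forall x, f x = r * amp t x,
      (tree_size t <= s)%N & (tree_depth t <= d)%N].

Lemma realizableW Q f s d s' d' : (s <= s')%N -> (d <= d')%N ->
  realizable Q f s d -> realizable Q f s' d'.
Proof.
move=> ss' dd' [t [r [tQ ok fE ts td]]]; exists t, r.
by split=> //; [exact: leq_trans ts _ | exact: leq_trans td _].
Qed.

Lemma realizable_leaf j (a b : C) x : (if x j then b else a) != 0 ->
  realizable [set j] (fun x => if x j then b else a) 1 0.
Proof.
move=> x0.
have lf : local_on [set j] (fun x : bits n => if x j then b else a).
  by move=> y y' /(_ j) ->; rewrite ?set11.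
have [r r0 Nr] := sqnorm_rescale lf x0.
have tE : amp (Leaf j (r^-1 * a) (r^-1 * b)) =1
    (fun x : bits n => r^-1 * if x j then b else a) by move=> y /=; case: ifP.
exists (Leaf j (r^-1 * a) (r^-1 * b)), r; split=> //.
  by rewrite /= andbT normalizedE -Nr; apply/eqP/eq_sqnorm.
by split=> // y; rewrite tE mulVKf ?gt_eqF.
Qed.

(** The edge labels undo the rescaling of the two children and normalize their sum. *)
Lemma realizable_add Q f g s1 s2 d1 d2 x : local_on Q f -> local_on Q g ->
  realizable Q f s1 d1 -> realizable Q g s2 d2 ->
  (mo -> forall x, f x = 0 \/ g x = 0) -> f x + g x != 0 ->
  realizable Q (fun x => f x + g x) (s1 + s2) (maxn d1 d2).+1.
Proof.
move=> fQ gQ [t1 [r1 [[tQ1 mo1] ok1 [r10 fE] ts1 td1]]].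
move=> [t2 [r2 [[tQ2 mo2] ok2 [r20 gE] ts2 td2]]] fg fgx.
have [|r r0 Nr] := @sqnorm_rescale Q (fun x => f x + g x) x _ fgx.
  by move=> y y' yy'; rewrite (fQ y y') // (gQ y y').
pose t := Plus Q [:: (r^-1 * r1, t1); (r^-1 * r2, t2)].
have tE : amp t =1 (fun x => r^-1 * (f x + g x)).
  by move=> y; rewrite /= !big_cons big_nil addr0 fE gE mulrDr !mulrA.
exists t, r; split.
- split=> // m; rewrite /manifestly_orthogonal /=; apply/andP; split; last first.
    by rewrite cats0 all_cat; apply/andP; split; [exact: mo1 | exact: mo2].
  rewrite /= !andbT; apply/forall_inP => y _.
  by case: (fg m y) => /eqP; rewrite ?fE ?gE mulf_eq0 gt_eqF //= => ->; rewrite ?orbT.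
- rewrite /= cats0 all_cat ok1 ok2 tQ1 tQ2 eqxx !andbT /=.
  by rewrite normalizedE -Nr; apply/eqP/eq_sqnorm.
- by split=> // y; rewrite tE mulVKf ?gt_eqF.
- by rewrite /= addn0 leq_add.
- by rewrite /= ltnS maxn0; lia.
Qed.

(** A tensor gate has no edge labels, but by [sqnormM] its state is already normalized; the factors
    of the children multiply. *)
Lemma realizable_mul Q1 Q2 f g s1 s2 d1 d2 : local_on Q1 f -> local_on Q2 g ->
  Q1 != set0 -> Q2 != set0 -> [disjoint Q1 & Q2] ->
  realizable Q1 f s1 d1 -> realizable Q2 g s2 d2 ->
  realizable (Q1 :|: Q2) (fun x => f x * g x) (s1 + s2) (maxn d1 d2).+1.
Proof.
move=> fQ gQ Q10 Q20 Q12 [t1 [r1 [[tQ1 mo1] ok1 [r10 fE] ts1 td1]]].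
move=> [t2 [r2 [[tQ2 mo2] ok2 [r20 gE] ts2 td2]]].
have lt1 : local_on Q1 (amp t1).
  by move=> y y' yy'; apply: (mulfI (lt0r_neq0 r10)); rewrite -!fE; exact: fQ.
have lt2 : local_on Q2 (amp t2).
  by move=> y y' yy'; apply: (mulfI (lt0r_neq0 r20)); rewrite -!gE; exact: gQ.
have N1 : sqnorm Q1 (amp t1) = 1.
  by have /andP[_ /eqP] := all_vertices_root ok1; rewrite tQ1.
have N2 : sqnorm Q2 (amp t2) = 1.
  by have /andP[_ /eqP] := all_vertices_root ok2; rewrite tQ2.
pose t := Tens (Q1 :|: Q2) [:: t1; t2].
have tE : amp t =1 (fun x => amp t1 x * amp t2 x).
  by move=> y; rewrite /= !big_cons big_nil mulr1.
exists t, (r1 * r2); split.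
- split=> // m; rewrite /manifestly_orthogonal /= cats0 all_cat.
  by apply/andP; split; [exact: mo1 | exact: mo2].
- rewrite /= cats0 all_cat ok1 ok2 tQ1 tQ2 !andbT /=; apply/andP; split; last first.
    by rewrite normalizedE (eq_sqnorm _ tE) sqnormM // N1 N2 mulr1.
  have Q1neq2 : Q1 != Q2.
    by apply: contraNneq Q10 => Q1E; move: Q12; rewrite -Q1E -setI_eq0 setIid.
  rewrite inE Q1neq2 /=; apply/and3P; split.
  + by rewrite cover_seq !big_cons big_nil setU0.
  + apply/finset.trivIsetP => A B; rewrite !inE.
    by move=> /orP[]/eqP-> /orP[]/eqP->; rewrite ?eqxx // disjoint_sym.
  + by rewrite !inE negb_or ![set0 == _]eq_sym Q10.
- split=> [|y]; first exact: mulr_gt0.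
  by rewrite tE fE gE mulrACA.
- by rewrite /= addn0 leq_add.
- by rewrite /= ltnS maxn0; lia.
Qed.

(* The factor a absorbs the scalars that disappear with the children without
   qubits. *)
Lemma formula_realizable Q f s d : formula mo Q f s d ->
  forall (a : C) x, a != 0 -> Q != set0 -> f x != 0 ->
  realizable Q (fun x => a * f x) s d.
Proof.
elim=> {Q f s d}[Q|b|j b c|Q f g s1 s2 d1 d2 Ff IHf Fg IHg fg|
  Q1 Q2 f g s1 s2 d1 d2 Ff IHf Fg IHg Q12] a x a0 Q0 fx.
- by rewrite eqxx in fx.
- by rewrite eqxx in Q0.
- rewrite (_ : (fun x => _) = fun x : bits n => if x j then a * c else a * b); last first.
    by apply: funext => y; case: ifP.
  by apply: (@realizable_leaf _ _ _ x); case: ifP fx => _ fx; rewrite mulf_neq0.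
- have [fQ gQ] := (formula_local Ff, formula_local Fg).
  (* A summand that vanishes identically cannot be normalized; it is deleted and the other one
     replaces the gate. *)
  have [/existsP[y fy]|] := boolP [exists y, f y != 0]; last first.
    rewrite negb_exists => /forallP f0.
    have {}f0 y : f y = 0 by apply/eqP; move: (f0 y); rewrite negbK.
    rewrite (_ : (fun x => _) = fun x => a * g x); last first.
      by apply: funext => y; rewrite f0 add0r.
    apply: (@realizableW _ _ s2 d2); [lia..|apply: (IHg _ x) => //].
    by rewrite f0 add0r in fx.
  have [/existsP[z gz]|] := boolP [exists z, g z != 0]; last first.
    rewrite negb_exists => /forallP g0.
    have {}g0 z : g z = 0 by apply/eqP; move: (g0 z); rewrite negbK.
    rewrite (_ : (fun x => _) = fun x => a * f x); last first.
      by apply: funext => z; rewrite g0 addr0.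
    by apply: (@realizableW _ _ s1 d1); [lia..|exact: (IHf _ y)].
  rewrite (_ : (fun x => _) = fun x => a * f x + a * g x); last first.
    by apply: funext => x'; rewrite mulrDr.
  apply: (@realizable_add _ _ _ _ _ _ _ x) => //.
  + by move=> y' z' yz; rewrite (fQ y' z').
  + by move=> y' z' yz; rewrite (gQ y' z').
  + exact: (IHf _ y).
  + exact: (IHg _ z).
  + by move=> m y'; case: (fg m y') => ->; rewrite mulr0; [left | right].
  + by rewrite -mulrDr mulf_neq0.
- have [fx0 gx0] : f x != 0 /\ g x != 0 by apply/andP; rewrite -negb_or -mulf_eq0.
  have [fQ gQ] := (formula_local Ff, formula_local Fg).
  have [Q1E|Q10] := eqVneq Q1 set0.
    rewrite (_ : (fun x => _) = fun y => (a * f x) * g y); last first.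
      by apply: funext => y; rewrite mulrA (fQ y x) // Q1E => i; rewrite inE.
    apply: (@realizableW _ _ s2 d2); [lia..|rewrite Q1E set0U in Q0 *].
    by apply: (IHg _ x) => //; rewrite mulf_neq0.
  have [Q2E|Q20] := eqVneq Q2 set0.
    rewrite (_ : (fun x => _) = fun y => (a * g x) * f y); last first.
      by apply: funext => y; rewrite mulrCA mulrC (gQ y x) // Q2E => i; rewrite inE.
    apply: (@realizableW _ _ s1 d1); [lia..|rewrite Q2E setU0 in Q0 *].
    by apply: (IHf _ x) => //; rewrite mulf_neq0.
  rewrite (_ : (fun x => _) = fun x => (a * f x) * (1 * g x)); last first.
    by apply: funext => y; rewrite mul1r mulrA.
  apply: realizable_mul => //; last exact: (IHg _ x (oner_neq0 _)); last exact: (IHf _ x).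
  + by move=> y y' yy'; rewrite (fQ y y').
  + by move=> y y' yy'; rewrite (gQ y y').
Qed.

End Trees.

(** * Choice of the base K and logarithmic estimates *)

Lemma exists_base (R : realType) (eps : R) : 0 < eps ->
  exists2 K : nat, (1 < K)%N & 2 <= K%:R `^ eps.
Proof.
move=> eps0; have b0 : 0 <= 2 `^ eps^-1 :> R by exact: powR_ge0.
exists (Num.bound (2 `^ eps^-1 : R)).
  rewrite -(@ltr_nat R) (le_lt_trans _ (archi_boundP b0)) //.
  have -> : 1%:R = 1 `^ eps^-1 :> R by rewrite powR1.
  by apply: ge0_ler_powR; rewrite ?invr_ge0 ?nnegrE ?(ltW eps0) ?ler0n ?ler1n.
have {1}-> : 2 = (2 `^ eps^-1) `^ eps :> R by rewrite -powRrM mulVf ?gt_eqF// powRr1.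
by apply: ge0_ler_powR; rewrite ?nnegrE ?(ltW eps0) ?ler0n ?(ltW (archi_boundP b0)).
Qed.

(** For s > 1 and i = [up_log K s], K^(i-1) < s gives 2^(i-1) <= (K^eps)^(i-1) <= s^eps; rounding up
    costs the factor 2. *)
Lemma up_log_bound_powR (R : realType) (eps : R) (K s : nat) :
  (1 < K)%N -> 0 <= eps -> 2 <= K%:R `^ eps -> (0 < s)%N ->
  (2 ^ up_log K s)%:R <= 2 * s%:R `^ eps.
Proof.
move=> K1 eps0 K2; case: s => [//|[_|s _]].
  by rewrite up_log1 powR1 mulr1 ler1n.
have /andP[] := up_log_bounds K1 (isT : 1 < s.+2)%N.
case: (up_log K s.+2) => [|j] /= ls sl; first by lia.
rewrite expnS natrM ler_pM2l ?ltr0n // natrX.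
apply: (@le_trans _ _ ((K%:R `^ eps) ^+ j)); first by rewrite lerXn2r ?nnegrE ?powR_ge0.
rewrite -powR_mulrn ?powR_ge0 // -powRrM mulrC powRrM powR_mulrn //.
by apply: ge0_ler_powR; rewrite ?nnegrE ?exprn_ge0 ?ler0n // -natrX ler_nat ltnW.
Qed.

(** For s > 1, 2^(i-1) <= K^(i-1) < s, and the last ln 2 is again at most ln s; at s = 1 both sides
    vanish. *)
Lemma up_log_bound_ln (R : realType) (K s : nat) : (1 < K)%N -> (0 < s)%N ->
  (up_log K s)%:R * ln 2 <= 2 * ln s%:R :> R.
Proof.
move=> K1; case: s => [//|[_|s _]]; first by rewrite up_log1 ln1 mulr0 mul0r.
have /andP[] := up_log_bounds K1 (isT : 1 < s.+2)%N.
case: (up_log K s.+2) => [|j] /= ls sl; first by lia.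
have s2 : ln 2 <= ln s.+2%:R :> R by rewrite ler_ln ?posrE ?ltr0n ?ler_nat.
suff js : j%:R * ln 2 <= ln s.+2%:R :> R by rewrite -natr1; lra.
rewrite mulr_natl -lnXn ?ltr0n // -natrX ler_ln ?posrE ?ltr0n ?expn_gt0 //.
by rewrite ler_nat (leq_trans _ (ltnW ls)) //; case: (j) => // j'; rewrite leq_exp2r.
Qed.

(** * Exact representation of the state, and the final constants *)

Lemma balanced_tree (R : realType) (n k i s d : nat) (mo : bool) (psi : bits n -> R[i]) :
  (0 < n)%N -> pure_state psi -> formula mo [set: 'I_n] psi s d ->
  (s <= k.+1 ^ i)%N ->
  exists t, [/\ tree_for psi t, mo -> manifestly_orthogonal t,
    (tree_size t <= 2 ^ i * s)%N & (tree_depth t <= 3 * k * i)%N].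
Proof.
move=> n0 psi1 F ski.
have Npsi : sqnorm [set: 'I_n] psi = 1 by exact/eqP.
have [x psix] : exists x, psi x != 0.
  apply/existsP; apply: contraT; rewrite negb_exists => /forallP psi0.
  have /esym/eqP := Npsi; rewrite /sqnorm big1 ?oner_eq0 // => y _.
  by move: (psi0 y); rewrite negbK => /eqP->; rewrite normr0 expr0n.
have [s' [d' [s's d'd F']]] := formula_balanced F ski.
have T0 : [set: 'I_n] != set0 by rewrite -card_gt0 cardsT card_ord.
have [t [r [[tT mot] ok [r0 psiE] ts td]]] := formula_realizable F' (oner_neq0 _) T0 psix.
have /andP[_ /eqP Nt] := all_vertices_root ok.
(* The positive factor r disappears because both psi and the root have norm 1. *)
have r1 : r = 1.
  apply/eqP; rewrite -sqrp_eq1 ?ltW // -(ger0_norm (ltW r0)) -[X in X == _]mulr1.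
  rewrite -[X in _ * X]Nt tT -[X in _ * X]/(sqnorm _ _) -sqnormZ -(eq_sqnorm _ psiE).
  by rewrite sqnormZ Npsi normr1 expr1n mulr1.
exists t; split=> //; [split|exact: leq_trans ts _|exact: leq_trans td _].
  by rewrite /quantum_state_tree tT eqxx.
by move=> y; have := psiE y; rewrite r1 !mul1r.
Qed.

Theorem theorem5 (R : realType) (eps : R) (heps : 0 < eps) :
  exists C : R,
    forall (n : nat) (psi : {ffun 'I_n -> bool} -> R[i]),
      (0 < n)%N -> pure_state psi ->
      (exists t : qtree R n,
         [/\ tree_for psi t,
             (tree_size t)%:R <= C * ((TS psi)%:R `^ (1 + eps)) &
             (tree_depth t)%:R <= C * ln (TS psi)%:R]) /\
      (exists t : qtree R n,
         [/\ mo_tree_for psi t,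
             (tree_size t)%:R <= C * ((MOTS psi)%:R `^ (1 + eps)) &
             (tree_depth t)%:R <= C * ln (MOTS psi)%:R]).
Proof.
have [[//|k] K1 K2] := exists_base heps.
have l2 : 0 < ln 2 :> R by rewrite ln_gt0 ?ltr1n.
pose D : R := (3 * k)%:R * 2 / ln 2; have D0 : 0 <= D.
  by rewrite /D mulr_ge0 ?mulr_ge0 ?invr_ge0 ?ler0n ?(ltW l2).
(* The size needs the constant 2 and the depth needs D. *)
exists (2 + D) => n psi n0 psi1.
have main (mo : bool) s : (exists t0, [/\ tree_for psi t0, mo -> manifestly_orthogonal t0
      & tree_size t0 = s]) ->
    exists t, [/\ tree_for psi t, mo -> manifestly_orthogonal t,
      (tree_size t)%:R <= (2 + D) * s%:R `^ (1 + eps)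
      & (tree_depth t)%:R <= (2 + D) * ln s%:R].
  move=> [t0 [[/andP[/eqP t0T ok] t0E] mo0 <-]]; set s0 := tree_size t0.
  have [|d] := @formula_of_tree _ _ mo t0 _ mo0.
    by apply: sub_all ok => v /andP[].
  rewrite t0T (funext t0E) => F.
  (* A nonzero vector of n qubits has at least n leaves. *)
  have s1 : (0 < s0)%N.
    have := formula_card F; rewrite cardsT card_ord => -[psi0|]; last by apply: leq_trans.
    have := oner_neq0 R[i]; rewrite -(eqP psi1) big1 ?eqxx // => y _.
    by rewrite psi0 normr0 expr0n.
  have [t [tpsi mot ts td]] := balanced_tree n0 psi1 F (up_logP s0 K1).
  exists t; split=> //.
    have -> : s0%:R `^ (1 + eps) = s0%:R * s0%:R `^ eps :> R.
      by rewrite powRD ?powRr1 // pnatr_eq0 -lt0n s1 implybT.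
    apply: (@le_trans _ _ (2 ^ up_log k.+1 s0 * s0)%:R); first by rewrite ler_nat.
    rewrite natrM mulrC mulrCA ler_wpM2l //.
    apply: le_trans (up_log_bound_powR K1 (ltW heps) K2 s1) _.
    by rewrite ler_wpM2r ?powR_ge0 // lerDl.
  have ln0 : 0 <= ln s0%:R :> R by rewrite ln_ge0 ?ler1n.
  apply: (@le_trans _ _ (3 * k * up_log k.+1 s0)%:R); first by rewrite ler_nat.
  rewrite natrM; apply: (@le_trans _ _ (D * ln s0%:R)); last by rewrite ler_wpM2r // lerDr.
  rewrite /D -!mulrA ler_wpM2l ?ler0n // mulrCA ler_pdivlMl // mulrC.
  exact: up_log_bound_ln.
have [[t tpsi ts] _] := TSP n0 psi1; have [[u [upsi umo] us] _] := MOTSP n0 psi1.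
split.
- have [|t' [t'psi _ sz dp]] := main false (TS psi); first by exists t.
  by exists t'.
- have [|u' [u'psi u'mo sz dp]] := main true (MOTS psi); first by exists u.
  by exists u'; split=> //; split=> //; exact: u'mo.
Qed.
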